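(* There is a computable function $f'\colon\mathbb{N}\to\mathbb{N}$ such that every regular matroid is elementarily $(f'(k),k)$-weakly base orderable for every positive integer $k$.
   Context: An ordered pair $(B_1,B_2)$ of bases of a matroid has the elementary $k$-exchange property if there exist $k$-element subsets $X\subseteq B_1\setminus B_2$, $Y\subseteq B_2\setminus B_1$ and a bijection $\varphi\colon X\to Y$ such that $(B_1\setminus Z)\cup\varphi(Z)$ is a basis for every $Z\subseteq X$. A matroid is elementarily $(\alpha,k)$-weakly base orderable if every ordered pair $(B_1,B_2)$ of bases with $|B_1\setminus B_2|\ge\alpha$ has the elementary $k$-exchange property. A matroid is regular if it is representable over every field. *)

(* Defs.v *)
From HB Require Import structures.
From mathcomp Require Import all_boot all_order all_algebra.
From Stdlib Require List.

Set Implicit Arguments.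
Unset Strict Implicit.
Unset Printing Implicit Defensive.

Inductive recfun : Type :=
| RZero : recfun
| RSucc : recfun
| RProj : nat -> recfun
| RComp : recfun -> list recfun -> recfun
| RPrec : recfun -> recfun -> recfun
| RMin  : recfun -> recfun.

Inductive reval : recfun -> seq nat -> nat -> Prop :=
| ev_zero v : reval RZero v 0
| ev_succ x v : reval RSucc (x :: v) x.+1
| ev_proj i v : i < size v -> reval (RProj i) v (nth 0 v i)
| ev_comp g hs v ys y :
    List.Forall2 (fun h z => reval h v z) hs ys -> reval g ys y ->
    reval (RComp g hs) v y
| ev_prec0 g h v y : reval g v y -> reval (RPrec g h) (0 :: v) y
| ev_precS g h n v z y :
    reval (RPrec g h) (n :: v) z -> reval h (n :: z :: v) y ->
    reval (RPrec g h) (n.+1 :: v) y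
| ev_min g v n :
    reval g (n :: v) 0 ->
    (forall m, m < n -> exists k, reval g (m :: v) k.+1) ->
    reval (RMin g) v n.

Definition computable (f : nat -> nat) : Prop :=
  exists p : recfun, forall n, reval p [:: n] (f n).

Definition is_matroid (T : finType) (bases : {set {set T}}) : Prop :=
  bases != set0 /\
  forall B1 B2, B1 \in bases -> B2 \in bases ->
    forall x, x \in B1 :\: B2 ->
      exists2 y, y \in B2 :\: B1 & y |: (B1 :\ x) \in bases.

Local Open Scope ring_scope.

Definition lin_indep (F : fieldType) (T : finType) (m : nat)
  (v : T -> 'rV[F]_m) (S : {set T}) : bool :=
  \rank (\matrix_(i < #|S|) v (enum_val i)) == #|S|.

Definition vec_basis (F : fieldType) (T : finType) (m : nat)
  (v : T -> 'rV[F]_m) (B : {set T}) : Prop :=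
  lin_indep v B /\
  forall S : {set T}, lin_indep v S -> B \subset S -> S = B.

Definition representable (F : fieldType) (T : finType)
  (bases : {set {set T}}) : Prop :=
  exists (m : nat) (v : T -> 'rV[F]_m),
    forall B : {set T}, B \in bases <-> vec_basis v B.

Definition regular (T : finType) (bases : {set {set T}}) : Prop :=
  forall F : fieldType, representable F bases.

Local Close Scope ring_scope.

Definition elem_k_exchange (T : finType) (bases : {set {set T}})
  (k : nat) (B1 B2 : {set T}) : Prop :=
  exists (X Y : {set T}) (phi : T -> T),
    [/\ X \subset B1 :\: B2, Y \subset B2 :\: B1, #|X| = k & #|Y| = k] /\
    [/\ {in X &, injective phi}, phi @: X = Y
      & forall Z : {set T}, Z \subset X -> (B1 :\: Z) :|: phi @: Z \in bases].

Definition elem_wbo (T : finType) (bases : {set {set T}}) (alpha k : nat)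
  : Prop :=
  forall B1 B2, B1 \in bases -> B2 \in bases ->
    alpha <= #|B1 :\: B2| -> elem_k_exchange bases k B1 B2.

(* Main.v *)
(* With B1 as reference basis, let A be the coordinate matrix over F_2 with rows
   B1 \ B2 and columns B2 \ B1. Its rows are distinct because B2 spans. Among
   2^m distinct rows one finds m rows r_i and columns c_i such that column c_i is
   constant on the rows after r_i, with value different from A(r_i, c_i). If this
   constant is often 0, a triangular k x k submatrix with nonzero diagonal
   appears. Otherwise Ramsey's theorem above the diagonal yields either a half
   graph, which contains such a triangular submatrix, or a 4 x 4 zero-diagonal
   all-ones pattern, which contains a Fano minor and so is excluded by comparing
   coordinates over F_2 and F_3. Pivoting on the first diagonal entry of a
   triangular submatrix does not change the remaining rows and columns, so any
   subset of its diagonal can be exchanged one pair at a time. *)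

Require Import Defs.
From mathcomp Require Import all_boot all_order all_algebra.
From mathcomp Require Import ring.

Set Implicit Arguments.
Unset Strict Implicit.
Unset Printing Implicit Defensive.

Import GRing.Theory.

(** * Computability of the bound *)

Lemma reval_comp1 (g h : recfun) (v : seq nat) (y z : nat) :
  reval h v y -> reval g [:: y] z -> reval (RComp g [:: h]) v z.
Proof.
move=> hP; apply: ev_comp; apply: List.Forall2_cons hP _.
exact: List.Forall2_nil.
Qed.

Lemma reval_comp2 (g h h' : recfun) (v : seq nat) (y y' z : nat) :
  reval h v y -> reval h' v y' -> reval g [:: y; y'] z ->
  reval (RComp g [:: h; h']) v z.
Proof.
move=> hP h'P; apply: ev_comp; apply: List.Forall2_cons hP _.
apply: List.Forall2_cons h'P _; exact: List.Forall2_nil.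
Qed.

Lemma computable_exp2_exp2_add6 : computable (fun k => 2 ^ (2 ^ (k + 6))).
Proof.
(* [RPrec] recurses on the head of the argument list, and its step function sees the counter at
   position 0 and the previous value at position 1. *)
pose add := RPrec (RProj 0) (RComp RSucc [:: RProj 1]).
have addP a b : reval add [:: a; b] (a + b).
  elim: a => [|a IHa]; first exact: ev_prec0 (@ev_proj 0 [:: b] isT).
  apply: ev_precS IHa _.
  exact: reval_comp1 (@ev_proj 1 [:: a; a + b; b] isT) (ev_succ _ _).
pose exp2 := RPrec (RComp RSucc [:: RZero]) (RComp add [:: RProj 1; RProj 1]).
have exp2P n : reval exp2 [:: n] (2 ^ n).
  elim: n => [|n IHn].
    exact: ev_prec0 (reval_comp1 (ev_zero _) (ev_succ _ _)).
  apply: ev_precS IHn _; rewrite expnS mul2n -addnn.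
  have projP := @ev_proj 1 [:: n; 2 ^ n] isT.
  exact: (reval_comp2 projP projP (addP _ _)).
pose sc g := RComp RSucc [:: g].
have scP g v n : reval g v n -> reval (sc g) v n.+1.
  by move=> gP; apply: reval_comp1 gP (ev_succ _ _).
exists (RComp exp2 [:: RComp exp2 [:: iter 6 sc (RProj 0)]]) => n.
apply: reval_comp1 (exp2P _); apply: reval_comp1 (exp2P _).
by rewrite addnC /=; do 6!apply: (scP); exact: (@ev_proj 0 [:: n]).
Qed.

(** * Ramsey's theorem and unavoidable patterns in a 0-1 matrix with distinct rows *)

Lemma pairwise_rev (X : Type) (r : rel X) (s : seq X) :
  pairwise r (rev s) = pairwise (fun x y => r y x) s.
Proof.
elim: s => //= x s IHs; rewrite rev_cons -cats1 pairwise_cat IHs /= andbT.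
by rewrite allrel1r all_rev.
Qed.

(** Split the tail by the relation of the head to each term; one class is large enough to recurse,
    and the head extends one of the two kinds of sublist. As [r] is only tested in list order, no
    symmetry is assumed. *)
Lemma ramsey_pairwise (X : eqType) (r : rel X) (a b : nat) (s : seq X) :
  2 ^ (a + b) <= size s ->
  (exists t, [/\ subseq t s, size t = a & pairwise r t]) \/
  (exists t, [/\ subseq t s, size t = b & pairwise (fun x y => ~~ r x y) t]).
Proof.
have [n] := ubnP (a + b); elim: n => // n IHn in a b s *.
case: a => [|a]; first by left; exists [::]; rewrite sub0seq.
case: b => [|b]; first by right; exists [::]; rewrite sub0seq.
rewrite addSn addnS ltnS => le_n; case: s => [|x s] le_s.
  by move: le_s; rewrite leqNgt expn_gt0.
rewrite expnS mul2n -addnn /= in le_s.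
pose s1 := filter (r x) s; pose s2 := filter (predC (r x)) s.
have Es : size s1 + size s2 = size s by rewrite !size_filter count_predC.
have [le1 | lt1] := leqP (2 ^ (a + b).+1) (size s1).
  have [||[t [st tn rt]]|[t [st tn rt]]] := IHn a b.+1 s1; rewrite ?addnS //.
  - left; exists (x :: t); rewrite /= eqxx tn rt andbT.
    split=> //; first exact: subseq_trans st (filter_subseq _ _).
    by apply/allP=> y /(mem_subseq st); rewrite mem_filter => /andP[].
  - right; exists t; split=> //.
    apply: subseq_trans st _; apply: subseq_trans (filter_subseq _ _) _.
    exact: subseq_cons.
(* The head fills the slack left by the strict bound on [s1]. *)
have le2 : 2 ^ (a + b).+1 <= size s2.
  rewrite -(leq_add2l (2 ^ (a + b).+1)); apply: leq_trans le_s _.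
  by rewrite -Es -addSn leq_add2r.
have [||[t [st tn rt]]|[t [st tn rt]]] := IHn a.+1 b s2; rewrite ?addSn //.
- left; exists t; split=> //.
  apply: subseq_trans st _; apply: subseq_trans (filter_subseq _ _) _.
  exact: subseq_cons.
- right; exists (x :: t); rewrite /= eqxx tn rt andbT.
  split=> //; first exact: subseq_trans st (filter_subseq _ _).
  by apply/allP=> y /(mem_subseq st); rewrite mem_filter => /andP[].
Qed.

(** Repeated halving: choose a column on which two rows differ, keep the rows with its majority
    value [b], and record that column together with a row of value [~~ b]. *)
Lemma separating_sequence (T : finType) (e : rel T) (C S : {set T}) (m : nat) :
  {in S &, forall x x', x != x' -> exists2 y, y \in C & e x y != e x' y} ->
  2 ^ m <= #|S| ->
  exists s : seq (T * T),
    [/\ size s = m, all (fun p => (p.1 \in S) && (p.2 \in C)) s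
      & pairwise (fun p q => e q.1 p.2 == ~~ e p.1 p.2) s].
Proof.
elim: m => [|m IHm] in S *; first by exists [::].
move=> sepS leS.
have /card_gt1P[x [x' [Sx Sx' ne_xx']]] : 1 < #|S|.
  by apply: leq_trans leS; rewrite -{1}(expn0 2) ltn_exp2l.
have [c Cc ne_e] := sepS _ _ Sx Sx' ne_xx'.
pose Sb b := [set z in S | e z c == b].
have ESb : #|Sb true| + #|Sb false| = #|S|.
  rewrite -(cardsID [set z | e z c] S); congr (_ + _); apply: eq_card => z.
    by rewrite !inE eqb_id.
  by rewrite !inE eqbF_neg andbC.
have [b leb] : exists b, 2 ^ m <= #|Sb b|.
  have [le1 | lt1] := leqP (2 ^ m) #|Sb true|; first by exists true.
  exists false; rewrite -(leq_add2l (2 ^ m)) addnn -mul2n -expnS.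
  by apply: leq_trans leS _; rewrite -ESb leq_add2r ltnW.
(* Both values occur in column [c], at [x] and at [x'], so one of these rows serves. *)
have [r Sr rb] : exists2 r, r \in S & e r c = ~~ b.
  have [eb | neb] := eqVneq (e x c) (~~ b); first by exists x.
  by exists x' => //; move: ne_e neb; case: (e x c) (e x' c) (b) => [] [] [].
have sSb : Sb b \subset S by apply/subsetP=> z; rewrite inE => /andP[].
have [|s [sz als prs]] := IHm (Sb b) _ leb.
  by apply: sub_in2 sepS => z /(subsetP sSb).
exists ((r, c) :: s); rewrite /= sz Sr Cc prs !andbT; split=> //.
  apply: sub_all (als) => p /andP[/(subsetP sSb) -> ->] //.
apply: sub_all (als) => p /andP[]; rewrite inE => /andP[_ /eqP ->] _.
by rewrite rb negbK.
Qed.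

Lemma unavoidable_submatrix (T : finType) (e : rel T) (S C : {set T}) (k : nat) :
  {in S &, forall x x', x != x' -> exists2 y, y \in C & e x y != e x' y} ->
  2 ^ (2 ^ (k + 6)) <= #|S| ->
  (exists t : seq (T * T),
    [/\ size t = k, all (fun p => (p.1 \in S) && (p.2 \in C)) t,
        all (fun p => e p.1 p.2) t & pairwise (fun p q => ~~ e p.1 q.2) t]) \/
  (exists t : seq (T * T),
    [/\ size t = 4, all (fun p => (p.1 \in S) && (p.2 \in C)) t,
        all (fun p => ~~ e p.1 p.2) t
      & pairwise (fun p q => e p.1 q.2 && e q.1 p.2) t]).
Proof.
move=> sepS leS; have [s [sz als prs]] := separating_sequence sepS leS.
pose P (p : T * T) := e p.1 p.2; pose s1 := filter P s.
pose s0 := filter (predC P) s.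
have Es : size s1 + size s0 = 2 ^ (k + 6).
  by rewrite !size_filter count_predC sz.
have P1 : all P s1 by apply: filter_all.
have P0 : all (predC P) s0 by apply: filter_all.
(* Since [k + 6 = (4 + k.+1).+1], one half of the sequence suffices: either [s0] meets the Ramsey
   bound for 4 and [k.+1], or [s1] has more than [k] terms. *)
have [le0 | lt0] := leqP (2 ^ (4 + k.+1)) (size s0); last first.
  have lek : k <= size s1.
    have : 2 ^ (4 + k.+1) <= size s1.
      rewrite -(leq_add2r (2 ^ (4 + k.+1))) addnn -mul2n -expnS.
      have -> : (4 + k.+1).+1 = k + 6 by rewrite !addnS addn0.
      by rewrite -Es leq_add2l ltnW.
    apply: leq_trans; rewrite ltnW // (leq_trans (ltn_expl k (ltnSn 1))) //.
    by rewrite leq_exp2l // addnS leqW // leq_addl.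
  have st : subseq (take k s1) s1 by apply: take_subseq.
  have st' : subseq (take k s1) s by apply: subseq_trans st (filter_subseq _ _).
  (* On [s1] the entries below the diagonal are 0; reversing the order moves these zeros above
     it. *)
  left; exists (rev (take k s1)); rewrite size_rev size_takel // !all_rev.
  split=> //.
  - by apply/allP=> p /(mem_subseq st') /(allP als).
  - by apply/allP=> p /(mem_subseq st) /(allP P1).
  - rewrite pairwise_rev; move: (subseq_pairwise st' prs).
    apply: (sub_in_pairwise (P := P)) => [p q Pp _ /eqP -> | ].
      by rewrite negbK.
    by apply/allP=> p /(mem_subseq st) /(allP P1).
have als0 : all (fun p => (p.1 \in S) && (p.2 \in C)) s0.
  by apply/allP=> p; rewrite mem_filter => /andP[_ /(allP als)].
have prs0 : pairwise (fun p q => e q.1 p.2) s0.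
  apply: (sub_in_pairwise (P := predC P)) (pairwise_filter _ prs) => //.
  by move=> p q nPp _ /eqP ->.
(* On [s0] all entries below the diagonal are 1, so Ramsey is applied to the entries above it. *)
have [[t [st tn rt]] | [t [st tn rt]]] :=
    ramsey_pairwise (fun p q => e p.1 q.2) le0.
  right; exists t; split=> //; first by apply/allP=> p /(mem_subseq st) /(allP als0).
    by apply/allP=> p /(mem_subseq st) /(allP P0).
  by rewrite pairwise_relI rt (subseq_pairwise st prs0).
have {als0} alt : all (fun p => (p.1 \in S) && (p.2 \in C)) t.
  by apply/allP=> p /(mem_subseq st) /(allP als0).
have {P0} P0 : all (predC P) t by apply/allP=> p /(mem_subseq st) /(allP P0).
have {prs0} prs0 := subseq_pairwise st prs0.
(* Pairing the row of each entry with the column of its predecessor turns the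
   strict half graph into a triangular matrix with nonzero diagonal. *)
left; case: t tn rt alt P0 prs0 {st} => // p t [tn] rt alt P0 prs0.
pose shift (q q' : T * T) := (q'.1, q.2); exists (pairmap shift p t).
have shift_all z q u : all (fun w => ~~ e z w.2) (q :: u) ->
    all (fun w => ~~ e z w.2) (pairmap shift q u).
  by elim: u q => //= q' u IHu q /andP[-> /IHu].
elim: t p k {sepS leS sz Es le0} tn rt alt P0 prs0 => [|q t IHt] p [|k] //= [tn].
case/andP=> /andP[npq rp] rt /and3P[/andP[Sp Cp] /andP[Sq Cq] alt].
case/and3P=> nPp nPq P0 /andP[/andP[eqp _] prs0].
have [|||| tk tS te tr] := IHt q k tn; rewrite //= ?Sq ?Cq ?nPq //.
rewrite tk ?Sq Cp eqp te tr !andbT; split=> //.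
(* The row of [q] is 0 in its own column because the diagonal is 0, and in later columns by the
   choice of [t]. *)
apply: shift_all; rewrite /= (negbTE nPq : e q.1 q.2 = false) /=.
by case/andP: rt.
Qed.

(** * Coordinates with respect to a basis, and pivoting *)

Local Open Scope ring_scope.

Definition coord (F : fieldType) (T : finType) (m : nat) (v : T -> 'rV[F]_m)
  (l : T -> 'cV[F]_m) (x y : T) : F := (v y *m l x) 0 0.

(** The dual basis as column vectors, indexed by the elements of [T] rather than by ordinals, so
    that changing the basis requires no reindexing. *)
Definition dual_system (F : fieldType) (T : finType) (m : nat)
  (v : T -> 'rV[F]_m) (B : {set T}) (l : T -> 'cV[F]_m) : Prop :=
  {in B &, forall x y, coord v l x y = (x == y)%:R} /\
  forall y, v y = \sum_(x in B) coord v l x y *: v x.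

Lemma rows_submx (F : fieldType) (T : finType) (m : nat) (v : T -> 'rV[F]_m)
  (S S' : {set T}) : S \subset S' ->
  (\matrix_(i < #|S|) v (enum_val i) <= \matrix_(i < #|S'|) v (enum_val i))%MS.
Proof.
move=> sSS'; apply/row_subP=> i; rewrite rowK.
have S'i := subsetP sSS' _ (enum_valP i).
apply: (eq_row_sub (enum_rank_in S'i (enum_val i))).
by rewrite rowK enum_rankK_in.
Qed.

(** A right inverse of the matrix with rows [B] has the dual functionals as columns; maximality of
    [B] amounts to spanning. *)
Lemma dual_systemP (F : fieldType) (T : finType) (m : nat) (v : T -> 'rV[F]_m)
  (B : {set T}) : vec_basis v B <-> exists l, dual_system v B l.
Proof.
set M := \matrix_(i < #|B|) v (enum_val i); split.
  case=> freeB maxB; pose P := pinvmx M.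
  (* The sum has exactly one term for [x] in [B] and is 0 elsewhere. *)
  pose l x := \sum_(i < #|B| | enum_val i == x) col i P.
  have lE i : l (enum_val i) = col i P.
    by rewrite /l (big_pred1 i) // => j; rewrite (inj_eq enum_val_inj).
  have coE i y : coord v l (enum_val i) y = (v y *m P) 0 i.
    by rewrite /coord lE colE mulmxA -colE mxE.
  have coE2 (i j : 'I_#|B|) : (v (enum_val j) *m P) 0 i = (i == j)%:R.
    rewrite -(rowK (fun i => v (enum_val i))) -row_mul mulmxVp //.
    by rewrite !mxE eq_sym.
  exists l; split=> [x y Bx By | y].
    rewrite -(enum_rankK_in Bx Bx) -(enum_rankK_in Bx By) coE coE2.
    by rewrite (inj_eq enum_val_inj).
  (* A vector outside the row space could be added to [B], against maximality. *)
  have yM : (v y <= M)%MS.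
    apply: contraT => nyM; have nBy : y \notin B.
      apply: contra nyM => By; apply: (eq_row_sub (enum_rank_in By y)).
      by rewrite rowK enum_rankK_in.
    have sB := subsetUr [set y] B.
    suff /maxB/(_ sB) E : lin_indep v (y |: B).
      by case/negP: nBy; rewrite -E setU11.
    rewrite /lin_indep eqn_leq rank_leq_row /=.
    apply: (@leq_trans #|B|.+1); first by rewrite cardsU1 nBy.
    rewrite -{1}(eqP freeB); apply: rank_ltmx.
    rewrite /ltmx rows_submx //=; apply: contra nyM; apply: submx_trans.
    have yU := setU11 y B; apply: (eq_row_sub (enum_rank_in yU y)).
    by rewrite rowK enum_rankK_in.
  rewrite -{1}(mulmxKpV yM) mulmx_sum_row [RHS]big_enum_val.
  by apply: eq_bigr => i _; rewrite rowK coE.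
case=> l [dualB spanB]; have freeB : lin_indep v B.
  rewrite /lin_indep -/M; apply/row_freeP.
  exists (\matrix_(i, j) l (enum_val j) i 0); apply/matrixP=> i j.
  have := dualB _ _ (enum_valP j) (enum_valP i).
  rewrite (inj_eq enum_val_inj) eq_sym !mxE => <-; rewrite /coord mxE.
  by apply: eq_bigr => z _; rewrite !mxE.
split=> // S freeS sBS; apply/esym/eqP; rewrite eqEcard sBS /=.
rewrite -(eqP freeS); apply: leq_trans (rank_leq_row M); apply: mxrankS.
apply/row_subP=> i; rewrite rowK spanB; apply: summx_sub => x Bx.
apply: scalemx_sub; apply: (eq_row_sub (enum_rank_in Bx x)).
by rewrite rowK enum_rankK_in.
Qed.

Lemma coord_sum (F : fieldType) (T : finType) (m : nat) (v : T -> 'rV[F]_m)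
  (l : T -> 'cV[F]_m) (A : {set T}) (a : T -> F) (x y : T) :
  v y = \sum_(z in A) a z *: v z ->
  coord v l x y = \sum_(z in A) a z * coord v l x z.
Proof.
rewrite {1}/coord => ->; rewrite mulmx_suml summxE.
by apply: eq_bigr => z _; rewrite -scalemxAl mxE.
Qed.

Lemma dual_pivot (F : fieldType) (T : finType) (m : nat) (v : T -> 'rV[F]_m)
  (B : {set T}) (l : T -> 'cV[F]_m) (x y : T) :
  dual_system v B l -> x \in B -> y \notin B -> coord v l x y != 0 ->
  exists2 l', dual_system v (y |: B :\ x) l' &
    forall x' z, x' \in B :\ x ->
      coord v l' x' z = coord v l x' z
                        - coord v l x' y / coord v l x y * coord v l x z.
Proof.
case; set c := coord v l => dualB spanB Bx nBy cxy.
(* Gaussian elimination on functionals: [l x] is scaled to be 1 at [y], and the others are corrected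
   to vanish there. *)
pose l' x' := if x' == y then (c x y)^-1 *: l x
              else l x' - (c x' y / c x y) *: l x.
have l'y z : coord v l' y z = c x z / c x y.
  by rewrite /coord /l' eqxx -scalemxAr mxE mulrC.
have l'x x' z : x' \in B :\ x -> coord v l' x' z = c x' z - c x' y / c x y * c x z.
  rewrite !inE => /andP[_ Bx']; rewrite /coord /l' ifN; last first.
    by apply: contraNneq nBy => <-.
  rewrite mulmxBr -scalemxAr; have subE (A D : 'M[F]_1) a :
      (A - a *: D) 0 0 = A 0 0 - a * D 0 0 by rewrite !mxE.
  exact: subE.
exists l' => //; split.
  move=> x1 x2 /setU1P[-> | B1] /setU1P[-> | B2].
  - by rewrite l'y eqxx divff.
  - rewrite l'y; case/setD1P: B2 => nex Bx2; rewrite dualB // eq_sym (negbTE nex).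
    by rewrite mul0r (negbTE (_ : y != x2)) //; apply: contraNneq nBy => ->.
  - rewrite l'x // divfK // subrr; case/setD1P: B1 => nex Bx1.
    by rewrite (negbTE (_ : x1 != y)) //; apply: contraNneq nBy => <-.
  - rewrite l'x //; case/setD1P: B1 => ne1 Bx1; case/setD1P: B2 => ne2 Bx2.
    rewrite [c x x2]dualB // [c x1 x2]dualB // [x == x2]eq_sym.
    by rewrite (negbTE ne2) mulr0 subr0.
move=> z; rewrite big_setU1 /=; last by rewrite !inE negb_and nBy orbT.
rewrite l'y; under eq_bigr => x' Bx' do rewrite l'x // scalerBl.
rewrite big_split /= sumrN.
(* Applied to [z] and to [y], this reduces the expansion of [v z] to a cancellation. *)
have spanD w : \sum_(x' in B :\ x) c x' w *: v x' = v w - c x w *: v x.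
  by rewrite [v w]spanB [in RHS](big_setD1 x) //= addrAC subrr add0r.
rewrite spanD; under eq_bigr => x' _.
  rewrite mulrAC -mulrA mulrC -scalerA; over.
rewrite -scaler_sumr spanD scalerBr scalerA divfK //.
by rewrite opprB [v z - _ + _]addrA subrK addrC subrK.
Qed.

(** * Bases read off from coordinates *)

(** A nonzero coordinate permits a pivot. If it is 0, then [l x] vanishes on the whole exchanged
    set; were that set spanning, [l x] would vanish at [x], where it is 1. *)
Lemma exchange_in_bases (F : fieldType) (T : finType) (bases : {set {set T}})
  (m : nat) (v : T -> 'rV[F]_m) (B : {set T}) (l : T -> 'cV[F]_m) (x y : T) :
  (forall A : {set T}, A \in bases <-> vec_basis v A) ->
  dual_system v B l -> x \in B -> y \notin B ->
  (y |: B :\ x \in bases) = (coord v l x y != 0).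
Proof.
move=> repr dB Bx nBy; apply/idP/idP=> [/repr/dual_systemP[l' [_ span']] | cxy].
  apply: contraTneq isT => cxy; have := dB.1 _ _ Bx Bx.
  rewrite (coord_sum _ _ (span' x)) big1 => [/esym/eqP|z /setU1P[-> | ]].
  - by rewrite eqxx oner_eq0.
  - by rewrite cxy mulr0.
  - case/setD1P=> nez Bz.
    by rewrite dB.1 // eq_sym (negbTE nez) mulr0.
by apply/repr/dual_systemP; have [l' dB' _] := dual_pivot dB Bx nBy cxy; exists l'.
Qed.

(** If two rows agree on [B2 :\: B1], then [l x] and [l x'] agree on all of [B2], both being 0 on
    [B1 :&: B2]. As [B2] spans, they agree at [x], where their values are 1 and 0. *)
Lemma coord_separates (F : fieldType) (T : finType)
  (m : nat) (v : T -> 'rV[F]_m) (B1 B2 : {set T}) (l : T -> 'cV[F]_m) :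
  dual_system v B1 l -> vec_basis v B2 ->
  {in B1 :\: B2 &, forall x x', x != x' ->
     exists2 y, y \in B2 :\: B1 & coord v l x y != coord v l x' y}.
Proof.
move=> dB /dual_systemP[l2 [_ span2]] x x' /setDP[B1x nB2x] /setDP[B1x' nB2x'] ne.
apply/exists_inP; apply: contraT => /exists_inPn eqc.
have /esym/eqP := coord_sum l x (span2 x).
rewrite (_ : \sum_(z in B2) _ = coord v l x' x); last first.
  rewrite (coord_sum _ _ (span2 x)); apply: eq_bigr => z B2z; congr (_ * _).
  have [B1z | nB1z] := boolP (z \in B1); last first.
    by apply/eqP; rewrite -[_ == _]negbK eqc // inE nB1z.
  have nez : x != z by apply: contraNneq nB2x => ->.
  have nez' : x' != z by apply: contraNneq nB2x' => ->.
  by rewrite !dB.1 // (negbTE nez) (negbTE nez').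
by rewrite !dB.1 // eqxx [x' == x]eq_sym (negbTE ne) eq_sym oner_eq0.
Qed.

Lemma triangular_exchange (F : fieldType) (T : finType)
  (bases : {set {set T}}) (m : nat) (v : T -> 'rV[F]_m) (B : {set T})
  (l : T -> 'cV[F]_m) (s : seq (T * T)) :
  (forall A : {set T}, A \in bases <-> vec_basis v A) ->
  dual_system v B l ->
  all (fun p => (p.1 \in B) && (p.2 \notin B)) s ->
  all (fun p => coord v l p.1 p.2 != 0) s ->
  pairwise (fun p q => coord v l p.1 q.2 == 0) s ->
  (B :\: [set:: map fst s]) :|: [set:: map snd s] \in bases.
Proof.
move=> repr; elim: s => [|[x y] s IHs] in B l *.
  by move=> dB _ _ _; rewrite set_nil setD0 setU0; apply/repr/dual_systemP; exists l.
move=> dB /= /andP[/andP[Bx nBy] BS] /andP[cxy cS] /andP[/allP cx prS].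
have [l' dB' cE] := dual_pivot dB Bx nBy cxy.
(* Distinctness from [x] and from [y] is forced by the coordinates: an equality would identify a
   zero entry with a nonzero one. *)
have s1 p : p \in s -> p.1 \in B :\ x.
  move=> sp; have /andP[Bp _] := allP BS _ sp; rewrite !inE Bp andbT.
  by apply: contraNneq (allP cS _ sp) => ->; apply: cx.
have s2 p : p \in s -> p.2 \notin y |: B :\ x.
  move=> sp; have /andP[_ nBp] := allP BS _ sp.
  rewrite !inE (negbTE nBp) andbF orbF.
  by apply: contraNneq cxy => <-; apply: cx.
(* The pivot correction has the factor [coord v l x q.2], which is 0 by triangularity. *)
have cEs p q : p \in s -> q \in s -> coord v l' p.1 q.2 = coord v l p.1 q.2.
  by move=> sp sq; rewrite cE ?s1 // (eqP (cx _ sq)) mulr0 subr0.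
have -> : B :\: [set:: x :: map fst s] :|: [set:: y :: map snd s] =
    (y |: B :\ x) :\: [set:: map fst s] :|: [set:: map snd s].
  apply/setP=> z; rewrite !inE.
  have [-> | nezy] := eqVneq z y => /=; last by rewrite negb_or andbCA andbA.
  rewrite orbT andbT; case: (boolP (y \in map fst s)) => //= /mapP[p sp yE].
  by have := s1 _ sp; rewrite -yE !inE (negbTE nBy) andbF.
apply: (IHs _ _ dB').
- by apply/allP=> p sp; rewrite s2 // in_setU s1 ?orbT.
- by apply/allP=> p sp; rewrite cEs // (allP cS).
- rewrite (eq_in_pairwise (P := mem s) (r' := fun p q => coord v l p.1 q.2 == 0)) //.
  by move=> p q sp sq; rewrite cEs.
Qed.

(** After the first pivot, the entry at [x'], [y'] is the 2 x 2 minor divided by the pivot. *)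
Lemma exchange2_in_bases (F : fieldType) (T : finType) (bases : {set {set T}})
  (m : nat) (v : T -> 'rV[F]_m) (B : {set T}) (l : T -> 'cV[F]_m)
  (x y x' y' : T) :
  (forall A : {set T}, A \in bases <-> vec_basis v A) ->
  dual_system v B l -> x \in B -> y \notin B -> x' \in B :\ x ->
  y' \notin y |: B -> coord v l x y != 0 ->
  (y' |: (y |: B :\ x) :\ x' \in bases) =
  (coord v l x y * coord v l x' y' - coord v l x' y * coord v l x y' != 0).
Proof.
move=> repr dB Bx nBy Bx' nBy' cxy.
have [l' dB' cE] := dual_pivot dB Bx nBy cxy.
rewrite (exchange_in_bases repr dB'); first last.
- apply: contra nBy'; rewrite !inE => /orP[-> //| /andP[_ ->]]; exact: orbT.
- by rewrite in_setU Bx' orbT.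
rewrite cE // -(mulrI_eq0 _ (mulfI cxy)); congr (_ != 0).
by field.
Qed.

(** The expression is the 3 x 3 determinant with zero diagonal. One pivot at [x1], [y2] reduces it,
    up to a nonzero factor, to a 2 x 2 minor. *)
Lemma exchange3_in_bases (F : fieldType) (T : finType) (bases : {set {set T}})
  (m : nat) (v : T -> 'rV[F]_m) (B : {set T}) (l : T -> 'cV[F]_m)
  (x1 x2 x3 y1 y2 y3 : T) :
  (forall A : {set T}, A \in bases <-> vec_basis v A) ->
  dual_system v B l -> x1 \in B -> x2 \in B :\ x1 -> x3 \in B :\ x1 :\ x2 ->
  y2 \notin B -> y1 \notin y2 |: B -> y3 \notin y1 |: (y2 |: B) ->
  coord v l x1 y1 = 0 -> coord v l x2 y2 = 0 -> coord v l x3 y3 = 0 ->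
  coord v l x1 y2 != 0 -> coord v l x2 y1 != 0 ->
  (y3 |: (y1 |: (y2 |: B :\ x1) :\ x2) :\ x3 \in bases) =
  (coord v l x1 y2 * coord v l x2 y3 * coord v l x3 y1 +
   coord v l x1 y3 * coord v l x2 y1 * coord v l x3 y2 != 0).
Proof.
move=> repr dB Bx1 Bx2 Bx3 ny2 ny1 ny3 c11 c22 c33 c12 c21.
have [l' dB' cE] := dual_pivot dB Bx1 ny2 c12.
have Bx3' : x3 \in B :\ x1 by move: Bx3; rewrite !inE => /andP[].
have sB : y2 |: B :\ x1 \subset y2 |: B by rewrite setUS // subsetDl.
rewrite (exchange2_in_bases repr dB'); first last.
- by rewrite cE // c22 mul0r mul0r subr0.
- by apply: contra ny3; apply: subsetP; rewrite setUS.
- move: Bx3; rewrite !inE => /and3P[-> -> ->]; exact: orbT.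
- by apply: contra ny1; apply: subsetP.
- by rewrite in_setU Bx2 orbT.
rewrite !cE // c11 c22 c33 -(mulrI_eq0 _ (mulfI c12)) -[in RHS]oppr_eq0.
congr (_ != 0).
by field.
Qed.

(** * Exclusion of the Fano pattern *)

Lemma F2_neq0 (a : 'F_2) : a != 0 -> a = 1.
Proof. by case: a => [[|[|]]] // i _; apply: val_inj. Qed.

(* Restricted to the rows x1, x2, x3, the pattern is that of the Fano matroid. *)
Lemma regular_no_fano (T : finType) (bases : {set {set T}}) (B : {set T})
  (x1 x2 x3 y1 y2 y3 y4 : T) :
  regular bases -> B \in bases ->
  [/\ x1 \in B, x2 \in B & x3 \in B] ->
  [/\ y1 \notin B, y2 \notin B, y3 \notin B & y4 \notin B] ->
  let e x y := y |: B :\ x \in bases in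
  [/\ ~~ e x1 y1, e x1 y2, e x1 y3 & e x1 y4] ->
  [/\ e x2 y1, ~~ e x2 y2, e x2 y3 & e x2 y4] ->
  [/\ e x3 y1, e x3 y2, ~~ e x3 y3 & e x3 y4] -> False.
Proof.
move=> reg BB [Bx1 Bx2 Bx3] [By1 By2 By3 By4] e
  [e11 e12 e13 e14] [e21 e22 e23 e24] [e31 e32 e33 e34].
have x12 : x1 != x2 by apply: contraNneq e11 => ->.
have x13 : x1 != x3 by apply: contraNneq e11 => ->.
have x23 : x2 != x3 by apply: contraNneq e22 => ->.
have y12 : y1 != y2 by apply: contraNneq e11 => ->.
have y13 : y1 != y3 by apply: contraNneq e11 => ->.
have y23 : y2 != y3 by apply: contraNneq e22 => ->.
have y14 : y1 != y4 by apply: contraNneq e11 => ->.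
have y24 : y2 != y4 by apply: contraNneq e22 => ->.
have y34 : y3 != y4 by apply: contraNneq e33 => ->.
(* Over every field, the vanishing of these entries, minors and this determinant is decided by
   [bases], so it transfers from F_2 to F_3. *)
have coords (F : fieldType) : exists c : T -> T -> F,
    [/\ forall x y, x \in B -> y \notin B -> e x y = (c x y != 0),
     forall x y x' y', x \in B -> y \notin B -> x' \in B :\ x ->
       y' \notin y |: B -> c x y != 0 ->
       (y' |: (y |: B :\ x) :\ x' \in bases) =
         (c x y * c x' y' - c x' y * c x y' != 0)
     & (y3 |: (y1 |: (y2 |: B :\ x1) :\ x2) :\ x3 \in bases) =
       (c x1 y2 * c x2 y3 * c x3 y1 + c x1 y3 * c x2 y1 * c x3 y2 != 0)].
  have [m [v repr]] := reg F; have /repr/dual_systemP[l dB] := BB.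
  have eE x y : x \in B -> y \notin B -> e x y = (coord v l x y != 0).
    exact: exchange_in_bases.
  exists (coord v l); split=> //.
    by move=> x y x' y' *; apply: exchange2_in_bases.
  apply: exchange3_in_bases => //; rewrite ?inE ?negb_or ?negb_and; last 5 first.
  - by apply/eqP; rewrite -[_ == _]negbK -eE.
  - by apply/eqP; rewrite -[_ == _]negbK -eE.
  - by apply/eqP; rewrite -[_ == _]negbK -eE.
  - by rewrite -eE.
  - by rewrite -eE.
  - by rewrite Bx2 eq_sym x12.
  - by rewrite Bx3 [x3 == _]eq_sym x23 eq_sym x13.
  - by rewrite y12.
  - by rewrite By3 ![y3 == _]eq_sym y13 y23.
have [c [cE c2 c3]] := coords 'F_2; have [d [dE d2 d3]] := coords 'F_3.
have one x y : x \in B -> y \notin B -> e x y -> c x y = 1.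
  by move=> Bx By; rewrite cE // => /F2_neq0.
(* An all-ones 2 x 2 submatrix is singular over F_2, so the corresponding minor also vanishes over
   F_3. *)
have minor2 x x' y : x \in B -> x' \in B -> y \notin B -> x != x' -> y != y4 ->
    e x y -> e x' y -> e x y4 -> e x' y4 -> d x y * d x' y4 = d x' y * d x y4.
  move=> Bx Bx' By nex ney exy ex'y exy4 ex'y4; apply/eqP; rewrite -subr_eq0.
  have Bx'x : x' \in B :\ x by rewrite !inE Bx' eq_sym nex.
  have By4y : y4 \notin y |: B by rewrite !inE negb_or By4 eq_sym ney.
  rewrite -[_ == _]negbK -d2 -?dE // c2 -?cE //.
  by rewrite !one.
have m1 := minor2 _ _ _ Bx2 Bx3 By1 x23 y14 e21 e31 e24 e34.
have m2 := minor2 _ _ _ Bx1 Bx3 By2 x13 y24 e12 e32 e14 e34.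
have m3 := minor2 _ _ _ Bx1 Bx2 By3 x12 y34 e13 e23 e14 e24.
(* Over F_2 the determinant is 1 + 1 = 0. *)
have : (y3 |: (y1 |: (y2 |: B :\ x1) :\ x2) :\ x3 \in bases) = false.
  by rewrite c3 !one.
rewrite d3 => /negbFE/eqP det0.
move: e12 e13 e14 e21 e24 e34; rewrite !dE // => d12 d13 d14 d21 d24 d34.
(* Since 2 is nonzero in F_3, this product is nonzero; the three minor relations turn it into a
   multiple of the vanishing determinant. *)
have : 2%:R * (d x1 y2 * d x1 y3 * d x2 y1 * d x2 y4 * d x3 y4) != 0.
  by rewrite !mulf_neq0.
case/eqP.
have -> : 2%:R * (d x1 y2 * d x1 y3 * d x2 y1 * d x2 y4 * d x3 y4)
  = d x1 y2 * (d x1 y3 * d x2 y4) * (d x2 y1 * d x3 y4)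
    + d x1 y3 * d x2 y1 * (d x1 y2 * d x3 y4) * d x2 y4 by ring.
rewrite m1 m2 m3.
have -> : d x1 y2 * (d x2 y3 * d x1 y4) * (d x3 y1 * d x2 y4) +
   d x1 y3 * d x2 y1 * (d x3 y2 * d x1 y4) * d x2 y4
  = (d x1 y2 * d x2 y3 * d x3 y1 + d x1 y3 * d x2 y1 * d x3 y2)
    * (d x1 y4 * d x2 y4) by ring.
by rewrite det0 mul0r.
Qed.

(** * From triangular submatrices to elementary exchange *)

(** Each [Z] selects a sublist of [t], which is again triangular, so [triangular_exchange] applies
    to it. *)
Lemma elem_k_exchange_triangular (F : fieldType) (T : finType)
  (bases : {set {set T}}) (m : nat) (v : T -> 'rV[F]_m) (B1 B2 : {set T})
  (l : T -> 'cV[F]_m) (t : seq (T * T)) :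
  (forall A : {set T}, A \in bases <-> vec_basis v A) ->
  dual_system v B1 l ->
  all (fun p => (p.1 \in B1 :\: B2) && (p.2 \in B2 :\: B1)) t ->
  all (fun p => coord v l p.1 p.2 != 0) t ->
  pairwise (fun p q => coord v l p.1 q.2 == 0) t ->
  elem_k_exchange bases (size t) B1 B2.
Proof.
move=> repr dB tB tc tr.
(* A repeated row would have an entry both zero and nonzero; likewise for columns. *)
have u1 : uniq (map fst t).
  rewrite uniq_pairwise pairwise_map; apply: sub_in_pairwise tc tr => p q _ cq /=.
  by apply: contraTneq => ->.
have u2 : uniq (map snd t).
  rewrite uniq_pairwise pairwise_map; apply: sub_in_pairwise tc tr => p q cp _ /=.
  by apply: contraTneq => <-.
pose phi x := nth x (map snd t) (index x (map fst t)).
have phiE p : p \in t -> phi p.1 = p.2.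
  move=> tp; rewrite /phi -{2 3}(nth_index p tp) -(nth_map p p.1) ?index_mem //.
  rewrite index_uniq ?size_map ?index_mem //.
  by rewrite (nth_map p) ?index_mem // nth_index.
pose X := [set:: map fst t]; pose Y := [set:: map snd t].
have sub_t (Z : {set T}) : Z \subset X ->
    phi @: Z = [set:: map snd [seq p <- t | p.1 \in Z]]
    /\ Z = [set:: map fst [seq p <- t | p.1 \in Z]].
  move=> sZX; split; apply/setP=> z; rewrite !inE.
    apply/imsetP/mapP=> [[x Zx ->] | [p]].
      have := subsetP sZX _ Zx; rewrite inE => /mapP[p tp xE].
      by exists p; rewrite ?mem_filter -?xE ?Zx // xE phiE.
    by rewrite mem_filter => /andP[Zp tp] ->; exists p.1; rewrite ?phiE.
  apply/idP/mapP=> [Zz | [p]]; last by rewrite mem_filter => /andP[Zp _] ->.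
  have := subsetP sZX _ Zz; rewrite inE => /mapP[p tp zE].
  by exists p; rewrite ?mem_filter -?zE ?Zz.
have XY : phi @: X = Y.
  have [-> _] := sub_t _ (subxx X).
  have /all_filterP-> // : all (fun p => p.1 \in X) t.
  by apply/allP=> p tp; rewrite inE map_f.
have cX : #|X| = size t by rewrite cardsE (card_uniqP u1) size_map.
have cY : #|Y| = size t by rewrite cardsE (card_uniqP u2) size_map.
exists X, Y, phi; split; split=> //.
- apply/subsetP=> z; rewrite inE => /mapP[p tp ->].
  by case/andP: (allP tB _ tp).
- apply/subsetP=> z; rewrite inE => /mapP[p tp ->].
  by case/andP: (allP tB _ tp).
- by apply/imset_injP; rewrite XY cX cY.
move=> Z /sub_t[-> EZ]; rewrite {1}EZ.
apply: triangular_exchange repr dB _ _ (pairwise_filter _ tr).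
  apply/allP=> p; rewrite mem_filter => /andP[_ /(allP tB)/andP[]].
  by rewrite !inE => /andP[_ ->] /andP[->].
by apply/allP=> p; rewrite mem_filter => /andP[_ /(allP tc)].
Qed.

(* The bound for regular matroids *)
Local Close Scope ring_scope.

Theorem theorem5p23 :
  exists f' : nat -> nat,
    computable f' /\
    forall (T : finType) (bases : {set {set T}}),
      is_matroid bases -> regular bases ->
      forall k : nat, 0 < k -> elem_wbo bases (f' k) k.
Proof.
(* The outer power pays for the separating sequence, the inner one for the diagonal split and
   Ramsey's theorem. *)
exists (fun k => 2 ^ (2 ^ (k + 6))); split; first exact: computable_exp2_exp2_add6.
move=> T bases _ reg k _ B1 B2 BB1 BB2 leB.
have [m [v repr]] := reg 'F_2.
have [l dB] := (dual_systemP v B1).1 ((repr B1).1 BB1).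
have eE x y : x \in B1 -> y \notin B1 ->
    (coord v l x y != 0%R) = (y |: B1 :\ x \in bases).
  by move=> Bx By; rewrite (exchange_in_bases repr dB).
(* Over F_2 an entry is determined by whether it is 0, so distinct rows have distinct supports. *)
have sep : {in B1 :\: B2 &, forall x x', x != x' ->
    exists2 y, y \in B2 :\: B1
             & (coord v l x y != 0%R) != (coord v l x' y != 0%R)}.
  move=> x x' Bx Bx' ne.
  have [y By nec] := coord_separates dB ((repr B2).1 BB2) Bx Bx' ne.
  exists y => //; apply: contra nec => /eqP E; move: E.
  have [-> /esym/negbFE/eqP-> // | /F2_neq0-> /esym] := eqVneq (coord v l x y) 0%R.
  by move/F2_neq0->.
have [] := unavoidable_submatrix sep leB.
  case=> t [<- tB tc tr]; apply: elem_k_exchange_triangular repr dB tB tc _.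
  by apply: sub_pairwise tr => p q; rewrite negbK.
case=> t [tn tB]; case: t tn tB => [|p1 [|p2 [|p3 [|p4 [|]]]]] //= _.
case/and5P=> /andP[/setDP[x1 _] /setDP[_ y1]] /andP[/setDP[x2 _] /setDP[_ y2]].
move=> /andP[/setDP[x3 _] /setDP[_ y3]] /andP[/setDP[x4 _] /setDP[_ y4]] _.
rewrite !eE // => /and5P[n1 n2 n3 _ _].
rewrite !andbT => /and3P[/and3P[/andP[e12 e21] /andP[e13 e31] /andP[e14 e41]]].
case/andP=> /andP[e23 e32] /andP[e24 e42] /andP[e34 e43].
(* The first three rows with all four columns form the excluded pattern: the fourth column is all
   ones on them. *)
by case: (@regular_no_fano T bases B1 p1.1 p2.1 p3.1 p1.2 p2.2 p3.2 p4.2).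
Qed.
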